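(* In the shared network, the average rates satisfy the lower bounds $$R_C^{(S)}\ \ge\ R_{Cl}^{(S)}:=\sup_{\beta}\ b_C\,p_a^{(S)}\log_2(1+\beta)\,\mathbb{P}_C^{(S)}(\beta),$$ and, for every D2D type $i$, $R_{D_i}^{(S)}\ge R_{Dl_i}^{(S)}$, where $$R_{Dl_i}^{(S)}:=\sup_{\beta}\left(p_{t_i}\min\{p_{f_i}B,\,b_{D_i}\}\log_2(1+\beta)\,\mathbb{P}_D^{(S)}(\beta)\right)+\frac{b_{D_i}}{b_Cw}(1-p_{t_i})R_{Cl}^{(S)},$$ the suprema being over SINR thresholds $\beta>0$. Here $$\mathbb{P}_C^{(S)}(\beta)=\int_0^\infty e^{-\beta P_B^{-1}r^\alpha\sigma^2}\exp\left(-\tilde\lambda_D\tfrac{2\pi^2/\alpha}{\sin(2\pi/\alpha)}\left(\beta\tfrac{P_D}{P_B}\right)^{2/\alpha}r^2-2\pi\rho^{(S)}\lambda_Br^2H_1(\beta,\alpha)\right)e^{-\lambda_B\pi r^2}2\lambda_B\pi r\,dr,$$ $$\mathbb{P}_D^{(S)}(\beta)=\int_0^\infty e^{-\beta P_D^{-1}v^\alpha\sigma^2}\exp\left(-\tilde\lambda_D\tfrac{2\pi^2/\alpha}{\sin(2\pi/\alpha)}\beta^{2/\alpha}v^2-2\pi\rho^{(S)}\lambda_Bv^2H_0(\beta,\alpha)\right)\frac{v}{\delta^2}e^{-\frac{v^2}{2\delta^2}}\,dv.$$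
   Context: In the shared network D2D links and the downlink cellular network use the same $B$ subbands. $\lambda_B,\lambda_U$ are the densities of base stations (BSs) and cellular users. There are $M$ types of potential D2D links; type $i$ has density $\lambda_{D_i}$, demand $b_{D_i}$ subbands, time hopping probability $p_{t_i}\in[0,1]$ (probability of D2D mode), frequency hopping probability $p_{f_i}\in[0,1]$. Cellular users demand $b_C$ subbands; $w>0$ is the penalty for potential D2D links transmitting via BSs. $P_B,P_D>0$ are transmit powers of BSs and D2D transmitters, $\sigma^2\ge0$ is the noise power, $\alpha>2$ the path loss exponent, $\delta>0$ the parameter of the Rayleigh-distributed D2D link distance, $\tilde\lambda_D=\sum_ip_{t_i}p_{f_i}\lambda_{D_i}$, $H_1(\beta,\alpha)=\int_1^\infty\frac{x}{1+\beta^{-1}x^\alpha}dx$, $H_0(\beta,\alpha)=\int_0^\infty\frac{x}{1+\beta^{-1}(P_D/P_B)x^\alpha}dx$, $$\rho^{(S)}=\min\left\{\tfrac{b_C\lambda_U+\sum_ib_{D_i}(1-p_{t_i})\lambda_{D_i}}{\lambda_BB},1\right\},\qquad p_a^{(S)}=\min\left\{\tfrac{7B\lambda_B}{9(b_C\lambda_U+\sum_ib_{D_i}(1-p_{t_i})\lambda_{D_i})},1\right\}.$$ $\mathbb{P}_C^{(S)}$ and $\mathbb{P}_D^{(S)}$ are the complementary cumulative distribution functions $\mathbb{P}(\mathrm{SINR}_C>\beta)$ and $\mathbb{P}(\mathrm{SINR}_D>\beta)$ of the (nonnegative) SINRs of the typical cellular user and the typical active D2D link. The average rates are $R_C^{(S)}=b_Cp_a^{(S)}\mathbb{E}[\log_2(1+\mathrm{SINR}_C)]=b_Cp_a^{(S)}\int_0^\infty\frac{\log_2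 e}{\beta+1}\mathbb{P}_C^{(S)}(\beta)d\beta$ and $R_{D_i}^{(S)}=p_{t_i}\min\{p_{f_i}B,b_{D_i}\}\int_0^\infty\frac{\log_2 e}{\beta+1}\mathbb{P}_D^{(S)}(\beta)d\beta+\frac{b_{D_i}}{b_Cw}(1-p_{t_i})R_C^{(S)}$. *)

(* Defs.v *)
From HB Require Import structures.
From mathcomp Require Import all_boot all_order all_algebra.
From mathcomp Require Import all_classical all_reals all_analysis.

Set Implicit Arguments.
Unset Strict Implicit.
Unset Printing Implicit Defensive.

Import Order.TTheory GRing.Theory Num.Theory.
Import numFieldNormedType.Exports.

Local Open Scope classical_set_scope.
Local Open Scope ring_scope.

(* Parameters of the shared network with [M] types of potential D2D links.
   [noise] is the noise power sigma^2 itself. Subband counts and demands are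
   allowed to be arbitrary reals. *)
Record sharedNetwork (R : realType) (M : nat) := SharedNetwork {
  numBands : R;                    (* B *)
  lambdaB : R;
  lambdaU : R;
  lambdaD : 'I_M -> R;
  demandC : R;                     (* b_C *)
  demandD : 'I_M -> R;             (* b_{D_i} *)
  timeHop : 'I_M -> R;             (* p_{t_i} *)
  freqHop : 'I_M -> R;             (* p_{f_i} *)
  penalty : R;                     (* w *)
  powB : R;                        (* P_B *)
  powD : R;                        (* P_D *)
  noise : R;                       (* sigma^2 *)
  pathLoss : R;                    (* alpha *)
  linkScale : R;                   (* delta *)
  numBands_gt0 : 0 < numBands;
  lambdaB_gt0 : 0 < lambdaB;
  lambdaU_gt0 : 0 < lambdaU;
  lambdaD_ge0 : forall i, 0 <= lambdaD i;
  demandC_gt0 : 0 < demandC;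
  demandD_ge0 : forall i, 0 <= demandD i;
  timeHop_itv : forall i, 0 <= timeHop i <= 1;
  freqHop_itv : forall i, 0 <= freqHop i <= 1;
  penalty_gt0 : 0 < penalty;
  powB_gt0 : 0 < powB;
  powD_gt0 : 0 < powD;
  noise_ge0 : 0 <= noise;
  pathLoss_gt2 : 2 < pathLoss;
  linkScale_gt0 : 0 < linkScale
}.

Section shared_network.
Context (R : realType) (M : nat) (N : sharedNetwork R M).

Local Notation leb := (@lebesgue_measure R).
Local Notation B := (numBands N).
Local Notation lB := (lambdaB N).
Local Notation lU := (lambdaU N).
Local Notation lD := (lambdaD N).
Local Notation bC := (demandC N).
Local Notation bD := (demandD N).
Local Notation pt := (timeHop N).
Local Notation pf := (freqHop N).
Local Notation PB := (powB N).
Local Notation PD := (powD N).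
Local Notation sigma2 := (noise N).
Local Notation alpha := (pathLoss N).
Local Notation delta := (linkScale N).

Definition log2 (x : R) : R := ln x / ln 2.

Definition activeD2D : R := \sum_(i < M) pt i * pf i * lD i.

Definition cellularLoad : R := bC * lU + \sum_(i < M) bD i * (1 - pt i) * lD i.

(* rho^(S) *)
Definition bandUsage : R := Num.min (cellularLoad / (lB * B)) 1.

(* p_a^(S) *)
Definition accessProb : R := Num.min (7 * B * lB / (9 * cellularLoad)) 1.

(* Both integrals converge for beta > 0 because alpha > 2, so the real-valued
   integral takes no default value. *)
Definition H1 (beta : R) : R :=
  \int[leb]_(x in `[1, +oo[) (x / (1 + beta^-1 * x `^ alpha)).

Definition H0 (beta : R) : R :=
  \int[leb]_(x in `[0, +oo[) (x / (1 + beta^-1 * (PD / PB) * x `^ alpha)).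

Definition interfD : R :=
  activeD2D * ((2 * pi ^+ 2 / alpha) / sin (2 * pi / alpha)).

(* P_C^(S) *)
Definition coverageC (beta : R) : \bar R :=
  (\int[leb]_(r in `[0%R, +oo[)
    (expR (- (beta * PB^-1 * r `^ alpha * sigma2))
     * expR (- (interfD * (beta * (PD / PB)) `^ (2 / alpha) * r ^+ 2)
             - 2 * pi * bandUsage * lB * r ^+ 2 * H1 beta)
     * expR (- (lB * pi * r ^+ 2)) * (2 * lB * pi * r))%:E)%E.

(* P_D^(S) *)
Definition coverageD (beta : R) : \bar R :=
  (\int[leb]_(v in `[0%R, +oo[)
    (expR (- (beta * PD^-1 * v `^ alpha * sigma2))
     * expR (- (interfD * beta `^ (2 / alpha) * v ^+ 2)
             - 2 * pi * bandUsage * lB * v ^+ 2 * H0 beta)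
     * (v / delta ^+ 2) * expR (- (v ^+ 2 / (2 * delta ^+ 2))))%:E)%E.

Definition rateC d (T : measurableType d) (P : probability T R)
    (SINR : {RV P >-> R}) : \bar R :=
  ((bC * accessProb)%:E * 'E_P[(fun t => log2 (1 + SINR t)%R)])%E.

Definition rateD (RC : \bar R) (i : 'I_M) : \bar R :=
  ((pt i * Num.min (pf i * B) (bD i))%:E
     * \int[leb]_(beta in `]0%R, +oo[)
         ((log2 (expR 1) / (beta + 1))%:E * coverageD beta)
   + (bD i / (bC * penalty N) * (1 - pt i))%:E * RC)%E.

Definition lowerRateC : \bar R :=
  ereal_sup [set ((bC * accessProb * log2 (1 + beta))%:E * coverageC beta)%E
            | beta in [set beta : R | 0 < beta]].

Definition lowerRateD (i : 'I_M) : \bar R :=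
  (ereal_sup [set ((pt i * Num.min (pf i * B) (bD i) * log2 (1 + beta))%:E
                    * coverageD beta)%E
             | beta in [set beta : R | (0 < beta)%R]]
   + (bD i / (bC * penalty N) * (1 - pt i))%:E * lowerRateC)%E.

End shared_network.

(* Main.v *)
Require Import Defs.
From HB Require Import structures.
From mathcomp Require Import all_boot all_order all_algebra.
From mathcomp Require Import all_classical all_reals all_analysis.
From mathcomp Require Import measurable_realfun.
Import Order.TTheory GRing.Theory Num.Theory.
Import numFieldNormedType.Exports.
Local Open Scope classical_set_scope.
Local Open Scope ring_scope.

(* For every threshold [beta], log2 (1 + SINR) is at least log2 (1 + beta) on the
   event SINR > beta, so Markov's inequality bounds the cellular rate.  In the
   D2D rate, given as an integral over thresholds, the coverage probability is
   nonincreasing, hence at least its value at [beta] on ]0, beta], and the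
   weight (log2 e)/(x + 1) has integral log2 (1 + beta) there. *)

Lemma ln2_gt0 (R : realType) : 0 < ln 2 :> R.
Proof. by rewrite ln_gt0// ltr1n. Qed.

Lemma log2_onepD_ge0 {R : realType} [x : R] : 0 <= x -> 0 <= log2 (1 + x).
Proof. by move=> x0; rewrite divr_ge0 ?ln_ge0 ?lerDl// ltW ?ln2_gt0. Qed.

Lemma le_log2_onepD {R : realType} [x y : R] :
  0 <= x -> x <= y -> log2 (1 + x) <= log2 (1 + y).
Proof.
move=> x0 xy; rewrite ler_pM2r ?invr_gt0 ?ln2_gt0//.
by rewrite ler_ln ?lerD2l// posrE ltr_pwDl// (le_trans x0 xy).
Qed.

Lemma measurable_log2_onepD (R : realType) :
  measurable_fun [set: R] (fun x : R => log2 (1 + x)).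
Proof.
apply: measurable_funM; last exact: measurable_cst.
by apply: measurableT_comp; [exact: measurable_ln|exact: measurable_funD].
Qed.

(** Chain rule, with [log2 (expR 1)] equal to [(ln 2)^-1]: the weight of the rate integral is the
    derivative of [log2 (1 + x)], which supplies the antiderivative for its integral. *)
Lemma is_derive_log2_onepD {R : realType} [x : R] : 0 <= x ->
  is_derive x 1 (fun y : R => log2 (1 + y)) (log2 (expR 1) / (x + 1)).
Proof.
move=> x0; have x1 : 0 < 1 + x by rewrite ltr_pwDl.
have -> : (fun y : R => log2 (1 + y)) = (ln 2)^-1 *: (@ln R \o +%R 1).
  by apply/funext => y; rewrite /log2/= mulrC.
have dln : is_derive (1 + x) 1 (@ln R) (1 + x)^-1 := is_derive1_ln x1.
have dD : is_derive x 1 (+%R (1 : R)) 1.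
  by apply: is_derive_eq; rewrite add0r.
have := is_deriveZ (ln 2)^-1 (is_derive1_comp dln dD).
by rewrite /log2 expRK mulr1 div1r (addrC x).
Qed.

Lemma derivable_rate_weight {R : realType} [x : R] : 0 <= x ->
  derivable (fun y : R => log2 (expR 1) / (y + 1)) x 1.
Proof.
move=> x0; apply: derivableM => //; apply: derivableV => //.
by rewrite gt_eqF// ltr_wpDl.
Qed.

Lemma rate_weight_ge0 {R : realType} [x : R] : 0 <= x ->
  0 <= log2 (expR 1) / (x + 1).
Proof.
move=> x0; rewrite divr_ge0 ?addr_ge0//.
by rewrite /log2 expRK divr_ge0// ltW ?ln2_gt0.
Qed.

Lemma measurable_rate_weight (R : realType) :
  measurable_fun (`]0, +oo[ : set R) (fun x : R => log2 (expR 1) / (x + 1)).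
Proof.
apply: subspace_continuous_measurable_fun => //.
apply: derivable_within_continuous => x; rewrite in_itv/= andbT => x0.
exact/derivable_rate_weight/ltW.
Qed.

Lemma integral_rate_weight {R : realType} [b : R] : 0 < b ->
  (\int[lebesgue_measure]_(x in `]0%R, b]) (log2 (expR 1) / (x + 1))%:E
   = (log2 (1 + b))%:E)%E.
Proof.
(* The fundamental theorem of calculus works on a closed interval; adding the null set {0} leaves
   the integral unchanged. *)
move=> b0; rewrite integral_itv_obnd_cbnd; last first.
  apply/measurable_EFinP; apply: measurable_funS (@measurable_rate_weight R) => //.
  by apply: subset_itvl; rewrite bnd_simp.
have drv (x : R) : 0 <= x -> derivable (fun y : R => log2 (1 + y)) x 1.
  by move=> x0; have [] := is_derive_log2_onepD x0.
rewrite (continuous_FTC2 (F := fun y => log2 (1 + y))) //.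
- by rewrite addr0 /log2 ln1 mul0r sube0.
- apply: derivable_within_continuous => x; rewrite in_itv/= => /andP[x0 _].
  exact: derivable_rate_weight.
- have cont (x : R) : 0 <= x -> {for x, continuous (fun y : R => log2 (1 + y))}.
    by move=> /drv/derivable1_diffP/differentiable_continuous.
  split.
  + by move=> x; rewrite in_itv/= => /andP[/ltW x0 _]; exact: drv.
  + exact/cvg_at_right_filter/cont.
  + exact/cvg_at_left_filter/cont/ltW.
- move=> x; rewrite in_itv/= => /andP[/ltW x0 _].
  by rewrite derive1E; have [_ ->] := is_derive_log2_onepD x0.
Qed.

Lemma le_log2_ccdf {R : realType} {d} {T : measurableType d}
    {P : probability T R} {X : {RV P >-> R}} [b : R] :
  (forall t, 0 <= X t) -> 0 < b ->
  ((log2 (1 + b))%:E * ccdf X b <= 'E_P[(fun t => log2 (1 + X t)%R)])%E.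
Proof.
move=> X0 b0.
(* [markov] bounds the expectation of a function of the absolute value of [X]; as [X] is
   nonnegative, inserting [Num.norm] changes nothing. *)
have -> : (fun t => log2 (1 + X t)) =
    ((fun x : R => log2 (1 + x)) \o Num.norm) \o X.
  by apply/funext => t /=; rewrite ger0_norm.
apply: le_trans (markov X b0 (@measurable_log2_onepD R) _ _).
- apply: lee_wpmul2l; first by rewrite lee_fin log2_onepD_ge0 ?(ltW b0).
  have -> : ccdf X b = P (X @^-1` `]b, +oo[) by [].
  (* [ccdf] measures the strict event [b < X], which lies inside the event [b <= |X|] of Markov's
     inequality. *)
  apply: le_measure; rewrite ?inE.
  + exact: measurable_funPTI.
  + rewrite -[X in measurable X]setTI; apply: emeasurable_fun_c_infty => //.
    exact/measurable_EFinP/measurableT_comp.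
  + move=> t /=; rewrite in_itv/= andbT lee_fin => /ltW bX.
    by rewrite ger0_norm.
- exact: log2_onepD_ge0.
- by move=> x y; rewrite !nnegrE => x0 _; exact: le_log2_onepD.
Qed.

(** [F] is kept abstract so that it can be a [ccdf], which is measurable and nonincreasing on the
    whole line by general results. *)
Lemma le_log2_integral_nonincreasing {R : realType} [F : R -> \bar R] [b : R] :
  measurable_fun setT F -> (forall x, 0 <= F x)%E ->
  (forall x y, (x <= y)%R -> F y <= F x)%E -> 0 < b ->
  ((log2 (1 + b))%:E * F b <=
    \int[lebesgue_measure]_(x in `]0%R, +oo[)
      ((log2 (expR 1) / (x + 1))%:E * F x))%E.
Proof.
move=> mF F0 ndF b0.
have sub : (`]0, b] : set R) `<=` `]0, +oo[.
  by apply: subset_itvl; rewrite bnd_simp.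
have w0 (x : R) : 0 < x -> (0 <= (log2 (expR 1) / (x + 1))%:E)%E.
  by move=> /ltW x0; rewrite lee_fin rate_weight_ge0.
have mw := @measurable_rate_weight R.
have mwb : measurable_fun (`]0, b] : set R)
    (fun x : R => (log2 (expR 1) / (x + 1))%:E).
  by apply/measurable_EFinP; exact: measurable_funS sub mw.
have mwF : measurable_fun (`]0, +oo[ : set R)
    (fun x : R => (log2 (expR 1) / (x + 1))%:E * F x)%E.
  apply: emeasurable_funM; first exact/measurable_EFinP.
  exact: measurable_funTS.
(* The left side becomes the integral of the weight times the constant [F b] over ]0, b]. Replacing
   [F b] by [F x], then enlarging the domain, can only increase it. *)
rewrite -integral_rate_weight// -ge0_integralZr//; last first.
  by move=> x /=; rewrite in_itv/= => /andP[x0 _]; exact: w0.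
apply: (@le_trans _ _ (\int[lebesgue_measure]_(x in `]0%R, b])
    ((log2 (expR 1) / (x + 1))%:E * F x))%E); last first.
  apply: (ge0_subset_integral (@lebesgue_measure R) _ _ mwF _ sub) => //.
  by move=> x /=; rewrite in_itv/= andbT => x0; rewrite mule_ge0 ?w0.
apply: (ge0_le_integral (@lebesgue_measure R)) => //.
- by move=> x /=; rewrite in_itv/= => /andP[x0 _]; rewrite mule_ge0 ?w0.
- exact: emeasurable_funM.
- exact: measurable_funS sub mwF.
- move=> x /=; rewrite in_itv/= => /andP[x0 xb].
  by rewrite lee_wpmul2l ?w0// ndF.
Qed.

Section rates.
Context {R : realType} {M : nat} (N : sharedNetwork R M).

(** Strictness comes from the cellular users' term alone; the D2D terms are nonnegative because
    [timeHop] is at most 1. *)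
Lemma cellularLoad_gt0 : 0 < cellularLoad N.
Proof.
rewrite ltr_pwDl ?mulr_gt0 ?demandC_gt0 ?lambdaU_gt0//.
apply: sumr_ge0 => i _; have /andP[_ pt1] := timeHop_itv N i.
by rewrite !mulr_ge0 ?demandD_ge0 ?lambdaD_ge0 ?subr_ge0.
Qed.

Lemma accessProb_ge0 : 0 <= accessProb N.
Proof.
rewrite le_min ler01 andbT divr_ge0 ?mulr_ge0//.
- exact/ltW/numBands_gt0.
- exact/ltW/lambdaB_gt0.
- exact/ltW/cellularLoad_gt0.
Qed.

Lemma lowerRateC_le_rateC {d} {T : measurableType d} {P : probability T R}
    {X : {RV P >-> R}} :
  (forall t, 0 <= X t) ->
  (forall beta : R, 0 < beta -> ccdf X beta = coverageC N beta) ->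
  (lowerRateC N <= rateC N X)%E.
Proof.
move=> X0 Xccdf; apply: ge_ereal_sup => _ [b b0 <-].
rewrite -Xccdf// EFinM -muleA lee_wpmul2l ?le_log2_ccdf//.
by rewrite lee_fin mulr_ge0 ?accessProb_ge0// ltW ?demandC_gt0.
Qed.

(** The two summands are compared separately. The cellular one only needs a lower bound on [RC] and
    a nonnegative coefficient; the direct one is bounded threshold by threshold under the
    supremum. *)
Lemma lowerRateD_le_rateD {d} {T : measurableType d} {P : probability T R}
    {X : {RV P >-> R}} {RC : \bar R} (i : 'I_M) :
  (forall beta : R, 0 < beta -> ccdf X beta = coverageD N beta) ->
  (lowerRateC N <= RC)%E -> (lowerRateD N i <= rateD N RC i)%E.
Proof.
move=> Xccdf RCl; have /andP[pt0 pt1] := timeHop_itv N i.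
have /andP[pf0 _] := freqHop_itv N i.
apply: leeD; last first.
  rewrite lee_wpmul2l// lee_fin mulr_ge0 ?subr_ge0// divr_ge0 ?demandD_ge0//.
  by rewrite mulr_ge0// ltW ?demandC_gt0 ?penalty_gt0.
apply: ge_ereal_sup => _ [b b0 <-].
rewrite -Xccdf// EFinM -muleA lee_wpmul2l//.
  rewrite lee_fin mulr_ge0// le_min demandD_ge0 andbT mulr_ge0//.
  exact/ltW/numBands_gt0.
(* Monotonicity and measurability are read off from [ccdf X] instead of from the explicit integral
   [coverageD]. *)
apply: le_trans
  (le_log2_integral_nonincreasing (ccdf_measurable X) _ _ b0) _.
- by move=> x; exact: measure_ge0.
- by move=> x y; exact: ccdf_nonincreasing.
(* The domain ]0, +oo[ contains only positive thresholds, where [ccdf X] and [coverageD] agree, so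
   the two integrals are equal. *)
rewrite le_eqVlt; apply/orP; left; apply/eqP/eq_integral => x.
by rewrite inE/= in_itv/= andbT => /Xccdf ->.
Qed.

End rates.

Theorem corollary3 (R : realType) (M : nat) (N : sharedNetwork R M)
  (dC dD : measure_display)
  (TC : measurableType dC) (TD : measurableType dD)
  (PrC : probability TC R) (PrD : probability TD R)
  (SINRC : {RV PrC >-> R}) (SINRD : {RV PrD >-> R})
  (SINRC_ge0 : forall t, 0 <= SINRC t)
  (SINRD_ge0 : forall t, 0 <= SINRD t)
  (SINRC_ccdf : forall beta : R, 0 < beta -> ccdf SINRC beta = coverageC N beta)
  (SINRD_ccdf : forall beta : R, 0 < beta -> ccdf SINRD beta = coverageD N beta) :
  (lowerRateC N <= rateC N SINRC)%E /\
  (forall i : 'I_M, (lowerRateD N i <= rateD N (rateC N SINRC) i)%E).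
Proof.
have RC := lowerRateC_le_rateC N SINRC_ge0 SINRC_ccdf.
by split=> // i; exact: (lowerRateD_le_rateD N i SINRD_ccdf RC).
Qed.
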